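(* Let $k>1$ and consider rowmotion $\rho$ acting on $\mathcal{J}({\sf V}_k)$. For $2\le i\le k$ let $F_i=\chi_{\ell_i}+\chi_{r_i}+\chi_{c_{i-1}}$. Then for every $i$ with $2\le i\le k$, the statistic $F_i-F_{k+2-i}$ is $\frac{3(k+2-2i)}{k+2}$-mesic.
   Context: ${\sf V}$ is the 3-element poset with elements $c,\ell,r$ and relations $c<\ell$, $c<r$. ${\sf V}_k={\sf V}\times[k]$ with the product order, where $[k]=\{1<\dots<k\}$; write $\ell_i=(\ell,i)$, $c_i=(c,i)$, $r_i=(r,i)$. For $s\in{\sf V}_k$, $\chi_s$ is the indicator function on order ideals ($\chi_s(I)=1$ iff $s\in I$). $\mathcal{J}(P)$ is the set of order ideals of $P$; rowmotion $\rho$ sends an order ideal $I$ to the order ideal generated by the minimal elements of $P\setminus I$. A statistic $g$ is $c$-mesic under $\rho$ if its average over every $\rho$-orbit equals $c$. *)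

(* Defs.v *)
From HB Require Import structures.
From mathcomp Require Import all_boot all_order all_algebra.

Set Implicit Arguments.
Unset Strict Implicit.
Unset Printing Implicit Defensive.

Import Order.TTheory GRing.Theory Num.Theory.

Section OrderIdeals.
Variables (d : Order.disp_t) (P : finPOrderType d).
Local Open Scope order_scope.

Definition order_ideal (I : {set P}) : bool :=
  [forall x, forall y, (y \in I) && (x <= y) ==> (x \in I)].

Record ideal := Ideal { ideal_set :> {set P}; _ : order_ideal ideal_set }.

HB.instance Definition _ := [isSub for ideal_set].
HB.instance Definition _ := [Finite of ideal by <:].

Definition min_elts (A : {set P}) : {set P} :=
  [set x in A | [forall y in A, ~~ (y < x)]].

Definition gen_ideal (A : {set P}) : {set P} :=
  [set x | [exists y in A, x <= y]].

Fact gen_idealP (A : {set P}) : order_ideal (gen_ideal A).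
Proof.
apply/forallP=> x; apply/forallP=> y; apply/implyP; rewrite !inE.
case/andP=> /existsP[z /andP[zA yz]] xy.
by apply/existsP; exists z; rewrite zA (le_trans xy yz).
Qed.

Definition rowmotion (I : ideal) : ideal :=
  Ideal (gen_idealP (min_elts (~: ideal_set I))).

Definition chi (s : P) (I : ideal) : rat := ((s \in ideal_set I) : nat)%:R%R.

Lemma min_elts_below (A : {set P}) x :
  x \in A -> exists2 y, y \in min_elts A & y <= x.
Proof.
move: {2}#|[set z in A | z < x]|.+1 (ltnSn #|[set z in A | z < x]|) => n.
elim: n x => // n IHn x lt_n xA.
case: (boolP [forall y in A, ~~ (y < x)]) => [xmin|].
  by exists x; rewrite // inE xA.
case/forall_inPn=> y yA /negPn yx.
have [|z zA zy] := IHn y _ yA; last by exists z; rewrite // (le_trans zy (ltW yx)).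
move: lt_n; rewrite ltnS; apply: leq_trans; apply: proper_card; apply/properP; split.
  by apply/subsetP=> z; rewrite !inE => /andP[-> /lt_trans->].
by exists y; rewrite !inE yA ?yx ?ltxx.
Qed.

Lemma setC_ideal (I : ideal) x :
  (x \notin ideal_set I) =
  [exists y in min_elts (~: ideal_set I), y <= x].
Proof.
apply/idP/existsP => [xI | [y /andP[yI yx]]].
  have /min_elts_below[y yI yx] : x \in ~: ideal_set I by rewrite inE.
  by exists y; rewrite yI.
move: yI; rewrite !inE => /andP[yI _]; apply: contra yI => xI.
case: I xI => I /= /forallP/(_ y)/forallP/(_ x)/implyP idI xI.
by apply: idI; rewrite xI.
Qed.

Lemma gen_min_elts_sub (A B : {set P}) :
  gen_ideal (min_elts A) = gen_ideal (min_elts B) ->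
  min_elts A \subset min_elts B.
Proof.
move=> eqAB; apply/subsetP=> x xA.
have : x \in gen_ideal (min_elts A).
  by rewrite inE; apply/existsP; exists x; rewrite xA /=.
rewrite eqAB inE => /existsP[y /andP[yB xy]].
have : y \in gen_ideal (min_elts B).
  by rewrite inE; apply/existsP; exists y; rewrite yB /=.
rewrite -eqAB inE => /existsP[z /andP[zA yz]].
suff -> : x = y by [].
apply/eqP; rewrite eq_le xy /=.
have xz := le_trans xy yz.
move: zA; rewrite inE => /andP[_ /forall_inP/(_ x)].
move: (xA); rewrite inE => /andP[-> _] /(_ isT).
by rewrite lt_neqAle xz andbT negbK => /eqP->.
Qed.

(* Hence the forward orbits used in mesic below are genuine orbits *)
Lemma rowmotion_inj : injective rowmotion.
Proof.
move=> I J /(congr1 ideal_set) /= eqIJ; apply/val_inj/setP=> x /=.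
apply/negb_inj; rewrite !setC_ideal.
suff -> : min_elts (~: ideal_set I) = min_elts (~: ideal_set J) by [].
by apply/eqP; rewrite eqEsubset !gen_min_elts_sub.
Qed.

End OrderIdeals.

Section Homomesy.
Local Open Scope ring_scope.

Definition orbit_average (T : finType) (f : T -> T) (g : T -> rat) (x : T) : rat :=
  (\sum_(y <- orbit f x) g y) / (size (orbit f x))%:R.

Definition mesic (T : finType) (f : T -> T) (c : rat) (g : T -> rat) : Prop :=
  forall x : T, orbit_average f g x = c.

End Homomesy.

Inductive V : predArgType := Vc | Vl | Vr.

Definition V_to_ord (x : V) : 'I_3 :=
  match x with Vc => inord 0 | Vl => inord 1 | Vr => inord 2 end.

Definition V_of_ord (i : 'I_3) : V :=
  match val i with 0 => Vc | 1 => Vl | _ => Vr end.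

Fact V_to_ordK : cancel V_to_ord V_of_ord.
Proof. by case; rewrite /V_of_ord /= inordK. Qed.

HB.instance Definition _ := Finite.copy V (can_type V_to_ordK).

Definition leV (x y : V) : bool :=
  match x, y with
  | Vc, _ | Vl, Vl | Vr, Vr => true
  | _, _ => false
  end.

Fact leV_refl : reflexive leV. Proof. by case. Qed.
Fact leV_anti : antisymmetric leV. Proof. by do 2!case. Qed.
Fact leV_trans : transitive leV. Proof. by do 3!case. Qed.

Fact V_display : Order.disp_t. Proof. exact: Order.Disp tt tt. Qed.

HB.instance Definition _ :=
  Order.Le_isPOrder.Build V_display V leV_refl leV_anti leV_trans.

(* The element i of the chain 1 < ... < k is the ordinal i.-1 of 'I_k *)
Definition Vk (k : nat) := (V *p 'I_k)%type.

HB.instance Definition _ (k : nat) := Order.FinPOrder.on (Vk k).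

Fact chain_bound (k i : nat) : 0 < i <= k -> i.-1 < k.
Proof. by case: i. Qed.

Definition elt (k : nat) (x : V) (i : nat) (hi : 0 < i <= k) : Vk k :=
  (x, Ordinal (chain_bound hi)).

Fact index_bound (k i : nat) : 2 <= i <= k -> 0 < i <= k.
Proof. by case/andP=> /ltnW -> ->. Qed.

Fact pred_bound (k i : nat) : 2 <= i <= k -> 0 < i - 1 <= k.
Proof. by case/andP=> i2 ik; rewrite subn_gt0 i2 (leq_trans (leq_subr _ _) ik). Qed.

Fact mirror_bound (k i : nat) : 2 <= i <= k -> 2 <= k + 2 - i <= k.
Proof.
case/andP=> i2 ik; rewrite addnC -addnBA // leq_addr /=.
by rewrite addnBA // leq_subLR leq_add2r.
Qed.

Definition F (k i : nat) (hi : 2 <= i <= k) (I : ideal (Vk k)) : rat :=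
  (chi (elt Vl (index_bound hi)) I + chi (elt Vr (index_bound hi)) I
   + chi (elt Vc (pred_bound hi)) I)%R.

Arguments F k i hi I : clear implicits.

(* Main.v *)
(** An order ideal of [V_k] is a triple [(l, c, r)] of fibre sizes with
    [l, r <= c <= k].  Rowmotion increments each entry, except that [l]
    (resp. [r]) returns to 0 when it equals [c], and [c = k] is replaced by the
    larger of the new side entries.  Read on the positions [l], [r], [c + 1], an
    orbit splits into paths climbing through 0, ..., k + 1: such a path goes up a
    side until it meets [c], and then goes up the centre.  If [g] is the centred
    contribution of a single position and [G] its discrete primitive, then [G]
    vanishes at 0 and k + 2, and the centred statistic is the coboundary of a sum
    of values of [G].  Only the ideals with [l = r] need a correction, since there
    two side paths merge; as [G w + G (k + 2 - w) = 0] and merges alternate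
    between the heights [w] and [k + 2 - w], that correction is a coboundary
    too. *)
Require Import Defs.
From HB Require Import structures.
From mathcomp Require Import all_boot all_order all_algebra.
From mathcomp Require Import zify ring lra.

Set Implicit Arguments.
Unset Strict Implicit.
Unset Printing Implicit Defensive.

Import Order.TTheory GRing.Theory Num.Theory.

Local Open Scope ring_scope.

(** Injectivity closes the orbit into a cycle, so the telescoping sum returns to [h x]. *)
Lemma sum_orbit_coboundary (T : finType) (f : T -> T) (h : T -> rat) (x : T) :
  injective f -> \sum_(y <- orbit f x) (h (f y) - h y) = 0.
Proof.
move=> f_inj; rewrite /orbit; have := iter_order f_inj x.
move: (fingraph.order f x) => n eq_n.
rewrite -[RHS](subrr (h x)) -{2}eq_n -[X in _ - h X]/(iter 0 f x).
rewrite -(@telescope_sumr _ 0 n (fun m => h (iter m f x))) //.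
rewrite big_mkord (big_nth x) size_traject big_mkord.
by apply: eq_bigr => m _; rewrite nth_traject //= iterS.
Qed.

Lemma coboundary_mesic (T : finType) (f : T -> T) (c : rat) (g h : T -> rat) :
  injective f -> (forall x, g x - c = h (f x) - h x) -> mesic f c g.
Proof.
move=> f_inj gE x; rewrite /orbit_average.
have n_gt0 : (size (orbit f x))%:R != 0 :> rat.
  by rewrite pnatr_eq0 size_orbit -lt0n order_gt0.
apply: (mulIf n_gt0); rewrite divfK //.
have := @sum_orbit_coboundary _ f h x f_inj.
under eq_bigr => y _ do rewrite -gE.
rewrite sumrB => /eqP; rewrite subr_eq0 => /eqP->.
by rewrite big_const_seq count_predT iter_addr_0 mulr_natr.
Qed.

Section Fibres.
Variable k : nat.
Implicit Types (I : ideal (Vk k)) (x : V) (j : 'I_k).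

Definition fibre_size x I : nat := #|[set j : 'I_k | (x, j) \in ideal_set I]|.

Lemma leVkE x y j j' : (((x, j) : Vk k) <= (y, j'))%O = leV x y && (j <= j')%N.
Proof. by []. Qed.

Lemma ideal_down I x y j j' :
  (y, j') \in ideal_set I -> leV x y -> (j <= j')%N -> (x, j) \in ideal_set I.
Proof.
case: I => I /= /forallP/(_ (x, j))/forallP/(_ (y, j'))/implyP idI yI xy jj'.
by apply: idI; rewrite yI leVkE xy.
Qed.

Lemma card_ord_lt (n : nat) : (n <= k)%N -> #|[set j : 'I_k | (j < n)%N]| = n.
Proof.
move=> le_nk; rewrite -sum1_card -[RHS]card_ord -sum1_card.
rewrite (big_ord_widen k (fun=> 1%N) le_nk).
by apply: eq_bigl => j; rewrite inE.
Qed.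

Lemma fibre_size_le I x : (fibre_size x I <= k)%N.
Proof. by rewrite -[X in (_ <= X)%N](card_ord k) max_card. Qed.

(** A fibre is a down-set of a chain, hence an initial segment fixed by its cardinality. *)
Lemma mem_fibre I x j : ((x, j) \in ideal_set I) = (j < fibre_size x I)%N.
Proof.
apply/idP/idP => [xI | ].
  rewrite -[X in (X <= _)%N]card_ord_lt //.
  apply/subset_leq_card/subsetP => j'; rewrite !inE ltnS.
  exact: ideal_down xI (leV_refl x).
apply: contraTT => xI; rewrite -leqNgt.
rewrite -[X in (_ <= X)%N](@card_ord_lt j) ?(ltnW (ltn_ord _)) //.
apply/subset_leq_card/subsetP => j'; rewrite !inE ltnNge.
by apply: contraL => jj'; apply: contra xI => xI; apply: ideal_down xI (leV_refl x) jj'.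
Qed.

Lemma fibre_sizeE I x n :
  (n <= k)%N -> (forall j, ((x, j) \in ideal_set I) = (j < n)%N) ->
  fibre_size x I = n.
Proof.
move=> le_nk xE; rewrite -[RHS](card_ord_lt le_nk).
by apply: eq_card => j; rewrite !inE xE.
Qed.

Lemma fibre_size_center I x : (fibre_size x I <= fibre_size Vc I)%N.
Proof.
apply/subset_leq_card/subsetP => j; rewrite !inE => xI.
exact: ideal_down xI _ (leqnn j).
Qed.

(** Going down from [(x, j)] lowers [j] or passes from a side to the centre; the two conjuncts
    exclude a smaller missing element of either kind. *)
Lemma mem_min_elts I x j :
  ((x, j) \in min_elts (~: ideal_set I)) =
  ((j : nat) == fibre_size x I) && ((x == Vc) || (j < fibre_size Vc I)%N).
Proof.
rewrite !inE mem_fibre -leqNgt; apply/andP/andP.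
  case=> le_j /forall_inP jmin.
  have below y j' : leV y x -> (j' <= j)%N -> (y, j') != (x, j) :> Vk k ->
      (j' < fibre_size y I)%N.
    move=> yx j'j neq; rewrite -mem_fibre; apply/negPn/negP => yI.
    have := jmin (y, j'); rewrite !inE => /(_ yI); rewrite lt_neqAle leVkE yx j'j.
    by rewrite neq.
  split.
    rewrite eqn_leq le_j andbT leqNgt; apply/negP => lt_j.
    have lt_sj : (fibre_size x I < k)%N by apply: ltn_trans (ltn_ord j).
    have := @below x (Ordinal lt_sj) (leV_refl x) (ltnW lt_j).
    by rewrite ltnn xpair_eqE eqxx -val_eqE /= (ltn_eqF lt_j) => /(_ isT).
  case: eqP => //= /eqP x_c; apply: (below Vc) => //.
  by rewrite xpair_eqE eqxx andbT eq_sym.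
case=> /eqP eq_j cj; split; first by rewrite eq_j.
apply/forall_inP => -[y j']; rewrite inE mem_fibre -leqNgt => le_j'.
rewrite lt_neqAle leVkE; apply/negP => /and3P[neq yx j'j].
have [eq_yx|neq_yx] := eqVneq y x.
  move: neq; rewrite eq_yx xpair_eqE eqxx -val_eqE /= => /negP; apply.
  by rewrite eqn_leq j'j eq_j -eq_yx.
have [y_c x_c] : y = Vc /\ x != Vc.
  by move: yx neq_yx; case: (y); case: (x); rewrite ?eqxx // eq_sym.
move: cj le_j'; rewrite (negbTE x_c) y_c /= => cj.
by rewrite leqNgt (leq_ltn_trans j'j cj).
Qed.

Definition side_step (c s : nat) : nat := if (s < c)%N then s.+1 else 0.

Lemma mem_rowmotion I x j :
  reflect (exists y, [/\ leV x y, (j <= fibre_size y I)%N, (fibre_size y I < k)%N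
             & (y == Vc) || (fibre_size y I < fibre_size Vc I)%N])
          ((x, j) \in ideal_set (rowmotion I)).
Proof.
rewrite inE; apply: (iffP existsP) => [[[y j'] /andP[]] | [y [xy le_j lt_k cy]]].
  rewrite mem_min_elts leVkE => /andP[/eqP eq_j cy] /andP[xy jj'].
  by exists y; rewrite -eq_j xy jj' ltn_ord.
by exists (y, Ordinal lt_k); rewrite mem_min_elts leVkE /= eqxx xy cy.
Qed.

Lemma fibre_size_rowmotion_side I x : x <> Vc ->
  fibre_size x (rowmotion I) = side_step (fibre_size Vc I) (fibre_size x I).
Proof.
move=> /eqP x_c; have le_ck := fibre_size_le I Vc; have le_xc := fibre_size_center I x.
apply: fibre_sizeE => [|j]; rewrite /side_step; first by case: ltnP; lia.
apply/mem_rowmotion/idP => [[y [xy le_j lt_k cy]] | lt_j].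
  have eq_yx : y = x by move: xy x_c; case: (y); case: (x); rewrite ?eqxx.
  by move: cy; rewrite eq_yx (negbTE x_c) /= => ->; rewrite -eq_yx.
exists x; rewrite leV_refl (negbTE x_c) /=.
by move: lt_j; case: (ltnP (fibre_size x I)) => // ? ?; split=> //; lia.
Qed.

(** A centre generator sits at height [c], higher than any side generator; it exists only if
    [c < k], and otherwise the sides alone generate the centre. *)
Lemma fibre_size_rowmotion_center I :
  let c := fibre_size Vc I in
  fibre_size Vc (rowmotion I) =
  if (c < k)%N then c.+1
  else maxn (side_step c (fibre_size Vl I)) (side_step c (fibre_size Vr I)).
Proof.
move=> c; have le_ck : (c <= k)%N := fibre_size_le I Vc.
have le_lc : (_ <= c)%N := fibre_size_center I Vl.
have le_rc : (_ <= c)%N := fibre_size_center I Vr.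
apply: fibre_sizeE => [|j]; rewrite /side_step.
  by case: ltnP => ?; [|do 2!case: (ltnP (fibre_size _ I) c) => ?]; lia.
have Vlc : (Vl == Vc) = false by apply/eqP.
have Vrc : (Vr == Vc) = false by apply/eqP.
apply/mem_rowmotion/idP => [[[] [_ le_j lt_k]] | ]; rewrite ?Vlc ?Vrc /= -/c.
- by move=> _; rewrite lt_k.
- by move=> cy; case: (ltnP c k) => ?; rewrite ?leq_max ?cy ?ltnS ?le_j ?orbT //; lia.
- by move=> cy; case: (ltnP c k) => ?; rewrite ?leq_max ?cy ?ltnS ?le_j ?orbT //; lia.
case: (ltnP c k) => [ck|kc] lt_j; first by exists Vc; rewrite eqxx.
have [lt_jl|le_lj] := ltnP j (side_step c (fibre_size Vl I)).
  exists Vl; rewrite Vlc; move: lt_jl; rewrite /side_step -/c.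
  case: (ltnP (fibre_size Vl I) c) => // lc ?.
  by split=> //; lia.
exists Vr; rewrite Vrc; move: le_lj lt_j; rewrite /side_step -/c.
by case: (ltnP (fibre_size Vr I) c) => rc ? ?; split=> //; lia.
Qed.

End Fibres.

Section Potential.
Variables (k i : nat).
Hypothesis hi : (2 <= i <= k)%N.

(** A third of the claimed average, as [F] reads three positions. *)
Definition mean : rat := (k%:R + 2 - 2 * i%:R) / (k%:R + 2).

Definition centred (w : nat) : rat :=
  ((i <= w)%N : nat)%:R - ((k + 2 - i <= w)%N : nat)%:R - mean.

(** Truncation is intended: [(w - m)%N] counts the [v < w] with [m <= v]. *)
Definition primitive (w : nat) : rat :=
  (w - i)%N%:R - (w - (k + 2 - i))%N%:R - w%:R * mean.

Local Notation g := centred.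
Local Notation G := primitive.

Lemma primitiveS w : G w.+1 = G w + g w.
Proof.
rewrite /primitive /centred.
have E m : (w.+1 - m)%N = ((w - m) + (m <= w))%N by case: leqP; lia.
by rewrite !E !natrD -[w.+1]addn1 natrD; ring.
Qed.

Lemma primitive0 : G 0 = 0.
Proof. by rewrite /primitive !sub0n; ring. Qed.

Lemma primitive_antisym w w' : (w + w' = k + 2)%N -> G w = - G w'.
Proof.
move=> ww'; rewrite /primitive /mean.
have k2 : k%:R + 2 != 0 :> rat by rewrite -(natrD _ k 2) pnatr_eq0 addn2.
have -> : w'%:R = k%:R + 2 - w%:R :> rat by rewrite -(natrD _ k 2) -ww' natrD; ring.
(* The integers [w - i] and [w' - (k + 2 - i)] are opposite, so their truncations at 0 differ by
   [w - i]; add the same identity with [w] and [w'] swapped. *)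
have E : ((w - i) + (w' - i) + i =
    (w - (k + 2 - i)) + (w' - (k + 2 - i)) + (k + 2 - i))%N by lia.
have le_ik : (i <= k + 2)%N by lia.
have {}E := congr1 (fun n : nat => n%:R : rat) E.
rewrite !natrD (natrB _ le_ik) natrD in E.
have -> : (w - i)%N%:R = (w - (k + 2 - i))%N%:R + (w' - (k + 2 - i))%N%:R
   + (k%:R + 2 - i%:R) - (w' - i)%N%:R - i%:R :> rat by rewrite -E; ring.
by field.
Qed.

Lemma primitive_top : G (k + 2) = 0.
Proof. by rewrite (@primitive_antisym _ 0) ?primitive0 ?oppr0 ?addn0. Qed.

(* The last summand compensates the merge at [l = r = c], where the position
   [c + 1] continues two side paths at once. *)
Definition potential (l c r : nat) : rat :=
  G l + G r + (if (l == c) || (r == c) then 0 else G c.+1)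
  + (if l == r then (if (l < c)%N then G (c - l) else - G c.+1) / 2 else 0).

Lemma potential_step l c r : (l <= c)%N -> (r <= c)%N -> (c <= k)%N ->
  let l' := side_step c l in let r' := side_step c r in
  let c' := if (c < k)%N then c.+1 else maxn l' r' in
  potential l' c' r' - potential l c r = g l + g r + g c.+1.
Proof.
move=> le_lc le_rc le_ck; rewrite /potential /side_step /=.
(* As [G (k + 2) = 0], a path leaving the top of the centre contributes no boundary term. *)
have top : G k.+1 = - g k.+1 by have := primitive_top; rewrite addn2 primitiveS; lra.
have [lt_ck|le_kc] := ltnP c k.
  have [lt_lc|le_cl] := ltnP l c; have [lt_rc|le_cr] := ltnP r c.
  (* Here [c - l] is preserved, so any correction cancels. *)
  - rewrite !eqSS ltnS !subSS lt_lc !(ltn_eqF lt_lc) (ltn_eqF lt_rc) /= !primitiveS.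
    by case: eqP => _; ring.
  - have -> : r = c by lia.
    by rewrite !eqSS eqxx !(ltn_eqF lt_lc) /= !primitiveS primitive0; ring.
  - have -> : l = c by lia.
    rewrite !eqSS eqxx (ltn_eqF lt_rc) (gtn_eqF lt_rc) /= !primitiveS primitive0; ring.
  (* Both sides enter the centre at once; the missing [G c.+1] is the jump of the correction from
     [- G c.+1 / 2] to [G c.+1 / 2]. *)
  have [-> ->] : l = c /\ r = c by lia.
  by rewrite !eqxx /= subn0 !primitiveS primitive0; field.
have c_k : c = k by lia.
rewrite {c le_ck le_kc}c_k in le_lc le_rc *.
have [lt_lk|le_kl] := ltnP l k; have [lt_rk|le_kr] := ltnP r k.
- rewrite (ltn_eqF lt_lk) (ltn_eqF lt_rk) /=.
  have [lt_lr|lt_rl|->] := ltngtP l r.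
  + have -> : maxn l.+1 r.+1 = r.+1 by lia.
    rewrite eqxx orbT !eqSS (ltn_eqF lt_lr).
    by rewrite top !primitiveS; ring.
  + have -> : maxn l.+1 r.+1 = l.+1 by lia.
    rewrite eqxx !eqSS (gtn_eqF lt_rl) /=.
    by rewrite top !primitiveS; ring.
  (* The heights [k - r] and [r + 2] add up to [k + 2], so the old correction [G (k - r) / 2] equals
     the new one, [- G r.+2 / 2]. *)
  rewrite maxnn !eqxx ltnn /= top (@primitive_antisym (k - r)%N r.+2); last by lia.
  by rewrite !primitiveS; field.
- have -> : r = k by lia.
  by move: top; rewrite maxn0 !eqxx (ltn_eqF lt_lk) /= !primitiveS primitive0; lra.
- have -> : l = k by lia.
  by move: top; rewrite max0n !eqxx (gtn_eqF lt_rk) /= !primitiveS primitive0; lra.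
(* The full ideal goes to the empty one; their corrections involve the complementary heights [k + 1]
   and [1]. *)
have [-> ->] : l = k /\ r = k by lia.
rewrite !eqxx /= (@primitive_antisym 1%N k.+1) ?top; last by lia.
have := top; rewrite primitiveS primitive0; lra.
Qed.

End Potential.

Theorem theorem3p20 (k : nat) (hk : (1 < k)%N) (i : nat) (hi : (2 <= i <= k)%N) :
  mesic (@rowmotion _ (Vk k))
    (3 * (k%:R + 2 - 2 * i%:R) / (k%:R + 2))
    (fun I : ideal (Vk k) =>
       F k i hi I - F k (k + 2 - i)%N (mirror_bound hi) I).
Proof.
apply: (@coboundary_mesic _ _ _ _ (fun I : ideal (Vk k) => potential k i
   (fibre_size Vl I) (fibre_size Vc I) (fibre_size Vr I))) => [|I].
  exact: rowmotion_inj.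
rewrite (@fibre_size_rowmotion_side _ _ Vl) // (@fibre_size_rowmotion_side _ _ Vr) //.
rewrite fibre_size_rowmotion_center.
rewrite potential_step ?fibre_size_center ?fibre_size_le //.
have chiE x j hj : chi (@elt k x j hj) I = ((j <= fibre_size x I)%N : nat)%:R.
  by rewrite /chi mem_fibre /=; case: j hj => // j hj; rewrite ltnS.
rewrite /F !chiE /centred /mean.
(* The centre term tests [i - 1 <= c], that is [i <= c + 1]: hence the position [c + 1]. *)
have le_pred j n : (0 < j)%N -> (j - 1 <= n)%N = (j <= n.+1)%N by lia.
by rewrite !le_pred; [ring | lia | lia].
Qed.
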